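(* Let $\mathcal L$ be a logic over a countable language. If the Leibniz operator $\Omega\colon\mathrm{Th}\mathcal L\to\mathrm{Con}\,\mathbf{Fm}$ is order-reflecting (resp. almost order-reflecting), then for every algebra $\mathbf A$ the Leibniz operator $\Omega^{\mathbf A}$ is order-reflecting (resp. almost order-reflecting) over $\mathcal{F}i_{\mathcal L}\mathbf A$.
   Context: Fix an algebraic type and a countably infinite set of variables; $\mathbf{Fm}$ is the formula algebra. A logic $\mathcal L$ is a structural closure operator on sets of formulas; $\Gamma\vdash_{\mathcal L}\varphi$ means $\varphi$ is in the closure of $\Gamma$. A deductive filter of $\mathcal L$ over $\mathbf A$ is $F\subseteq A$ such that $\Gamma\vdash_{\mathcal L}\varphi$ and $h[\Gamma]\subseteq F$ for a homomorphism $h\colon\mathbf{Fm}\to\mathbf A$ imply $h(\varphi)\in F$; $\mathcal{F}i_{\mathcal L}\mathbf A$ is the set of these and $\mathrm{Th}\mathcal L=\mathcal{F}i_{\mathcal L}\mathbf{Fm}$. The Leibniz congruence $\Omega^{\mathbf A}F$ is the largest congruence of $\mathbf A$ compatible with $F$; $\Omega=\Omega^{\mathbf{Fm}}$. $\Omega^{\mathbf A}$ is order-reflecting over $\mathcal{F}i_{\mathcal L}\mathbf A$ if for all $F,G\in\mathcal{F}i_{\mathcal L}\mathbf A$, $\Omega^{\mathbf A}F\subseteq\Omega^{\mathbf A}G$ implies $F\subseteq G$; almost order-reflecting if this holds for all non-empty $F,G$. *)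

(* Defs.v *)
From mathcomp Require Import all_boot.
From mathcomp Require Import boolp classical_sets functions cardinality.
Set Implicit Arguments.
Unset Strict Implicit.
Unset Printing Implicit Defensive.
Local Open Scope classical_set_scope.

Record algtype := AlgType { op : Type; arity : op -> nat }.

Record algebra (S : algtype) := Algebra {
  carrier :> Type;
  interp : forall f : op S, ('I_(arity f) -> carrier) -> carrier }.
Arguments interp {S A} f : rename.

Section Algebras.
Variable S : algtype.

Definition is_hom (A B : algebra S) (h : A -> B) : Prop :=
  forall (f : op S) (x : 'I_(arity f) -> A),
    h (interp f x) = interp f (fun i => h (x i)).

Definition is_congruence (A : algebra S) (theta : set (A * A)) : Prop :=
  [/\ forall a, theta (a, a),
      forall a b, theta (a, b) -> theta (b, a),
      forall a b c, theta (a, b) -> theta (b, c) -> theta (a, c)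
    & forall (f : op S) (x y : 'I_(arity f) -> A),
        (forall i, theta (x i, y i)) -> theta (interp f x, interp f y)].

Definition compatible (A : algebra S) (F : set A) (theta : set (A * A)) : Prop :=
  forall a b, theta (a, b) -> F a -> F b.

Definition is_largest_compatible_congruence (A : algebra S) (F : set A)
    (theta : set (A * A)) : Prop :=
  [/\ is_congruence theta, compatible F theta
    & forall phi : set (A * A),
        is_congruence phi -> compatible F phi -> phi `<=` theta].

(* Used only to prove that a largest compatible congruence exists. *)
Inductive translation (A : algebra S) : (A -> A) -> Prop :=
| translation_id : translation id
| translation_op (t : A -> A) (f : op S) (i : 'I_(arity f))
    (c : 'I_(arity f) -> A) : translation t ->
    translation (fun a => t (interp f (fun j => if j == i then a else c j))).

Lemma largest_compatible_congruence_exists (A : algebra S) (F : set A) :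
  exists theta, is_largest_compatible_congruence F theta.
Proof.
exists [set p | forall t : A -> A, translation t -> (F (t p.1) <-> F (t p.2))].
split.
- split=> /=.
  + by [].
  + by move=> a b ab t /ab [? ?]; split.
  + by move=> a b c ab bc t tr; rewrite (ab t tr); exact: bc.
  + move=> f x y xy t tr.
    pose z (k : nat) (i : 'I_(arity f)) := if (i < k)%N then y i else x i.
    have -> : x = z 0 by [].
    have -> : y = z (arity f) by apply/funext => i; rewrite /z ltn_ord.
    move: {-2}(arity f) (leqnn (arity f)); elim=> [//|k IH] ltk.
    rewrite (IH (ltnW ltk)).
    pose i0 := Ordinal ltk.
    have := xy i0 _ (translation_op i0 (z k) tr).
    have -> : (fun j => if j == i0 then x i0 else z k j) = z k.
      by apply/funext => j; case: eqP => // ->; rewrite /z /= ltnn.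
    have -> // : (fun j => if j == i0 then y i0 else z k j) = z k.+1.
    apply/funext => j; case: eqP => [->|nj]; rewrite /z ?ltnSn// [in RHS]ltnS [in RHS]leq_eqVlt.
    by case: eqP => // jk; case: nj; exact: val_inj.
- by move=> a b ab Fa; apply/(ab id (translation_id A)).
- move=> phi [rfl sym _ cong] comp [a b] /= phiab t tr.
  elim: tr a b phiab => [a b ab|t' f i c _ IH a b ab].
    by split; apply: comp => //; exact: sym.
  by apply: IH; apply: cong => j; case: eqP.
Qed.

Definition Leibniz (A : algebra S) (F : set A) : set (A * A) :=
  sval (cid (largest_compatible_congruence_exists F)).

Lemma LeibnizP (A : algebra S) (F : set A) :
  is_largest_compatible_congruence F (Leibniz F).
Proof. exact: svalP (cid _). Qed.

Inductive formula (V : Type) :=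
| Var of V
| App (f : op S) of ('I_(arity f) -> formula V).

Definition Fm (V : Type) : algebra S := Algebra (@App V).

Record logic (V : Type) := Logic {
  cn :> set (Fm V) -> set (Fm V);
  cn_extensive : forall Gamma, Gamma `<=` cn Gamma;
  cn_monotone : forall Gamma Delta, Gamma `<=` Delta -> cn Gamma `<=` cn Delta;
  cn_idempotent : forall Gamma, cn (cn Gamma) = cn Gamma;
  cn_structural : forall sigma : Fm V -> Fm V, is_hom sigma ->
    forall Gamma, sigma @` cn Gamma `<=` cn (sigma @` Gamma) }.

Section Filters.
Variables (V : Type) (L : logic V).

Definition entails (Gamma : set (Fm V)) (phi : Fm V) : Prop := cn L Gamma phi.

Definition Fi (A : algebra S) : set (set A) :=
  [set F | forall Gamma phi, entails Gamma phi ->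
     forall h : Fm V -> A, is_hom h -> h @` Gamma `<=` F -> F (h phi)].

Definition Th : set (set (Fm V)) := @Fi (Fm V).

End Filters.
Arguments Fi {V} L A.

Definition order_reflecting (A : algebra S) (X : set (set A)) : Prop :=
  forall F G, X F -> X G -> Leibniz F `<=` Leibniz G -> F `<=` G.

Definition almost_order_reflecting (A : algebra S) (X : set (set A)) : Prop :=
  forall F G, X F -> X G -> F !=set0 -> G !=set0 ->
    Leibniz F `<=` Leibniz G -> F `<=` G.

End Algebras.
Arguments Fi {S V} L A.

(* Main.v *)
(** Suppose [a] lies in [F] but not in [G], where the Leibniz congruence of [F]
is contained in that of [G].  Two elements that are not congruent modulo the
Leibniz congruence of [F] are separated by a unary polynomial, which has
finitely many parameters.  Closing [a] (and a point of [G]) under the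
operations and under a choice of these parameters gives a countable subalgebra,
hence a homomorphic image of the formula algebra under some [h], and
[Leibniz (h @^-1` F) `<=` h^-1 (Leibniz F) `<=` h^-1 (Leibniz G) `<=`
Leibniz (h @^-1` G)].  The preimages are theories, so [h @^-1` F] is contained
in [h @^-1` G], which contradicts the choice of [a]. *)
Require Import Defs.
From mathcomp Require Import all_boot.
From mathcomp Require Import boolp classical_sets functions cardinality.
Set Implicit Arguments.
Unset Strict Implicit.
Unset Printing Implicit Defensive.
Local Open Scope classical_set_scope.

Section Translations.
Context {S : algtype}.
Implicit Types A B : algebra S.

Lemma congruence_translation A (theta : set (A * A)) (t : A -> A) x y :
  is_congruence theta -> translation t -> theta (x, y) -> theta (t x, t y).
Proof.
move=> [rfl _ _ cong] tt; elim: tt x y => [//|t' f i c _ IH] x y xy.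
by apply: IH; apply: cong => j; case: eqP.
Qed.

(* The arguments of [f] are replaced one at a time. *)
Lemma congruence_unary A (theta : set (A * A)) :
  (forall a, theta (a, a)) -> (forall a b, theta (a, b) -> theta (b, a)) ->
  (forall a b c, theta (a, b) -> theta (b, c) -> theta (a, c)) ->
  (forall (f : op S) (i : 'I_(arity f)) (c : 'I_(arity f) -> A) a b,
     theta (a, b) ->
     theta (interp f (fun j => if j == i then a else c j),
            interp f (fun j => if j == i then b else c j))) ->
  is_congruence theta.
Proof.
move=> rfl sym trans unary; split=> // f x y xy.
suff H (s : seq 'I_(arity f)) :
    theta (interp f x, interp f (fun j => if j \in s then y j else x j)).
  have := H (enum 'I_(arity f)); congr (theta (_, interp f _)).
  by apply/funext => j; rewrite mem_enum.
elim: s => [|i s IH]; first exact: rfl.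
pose c j := if j \in s then y j else x j.
apply: (trans _ _ _ IH).
have -> : (fun j => if j \in i :: s then y j else x j) =
          (fun j => if j == i then y i else c j).
  by apply/funext => j; rewrite inE; case: eqP => [->|].
have -> : (fun j => if j \in s then y j else x j) =
          (fun j => if j == i then c i else c j).
  by apply/funext => j; case: eqP => [->|].
by apply: unary; rewrite /c; case: ifP.
Qed.

(** Being separated by no translation is a congruence compatible with [F], hence lies below the
    largest one. *)
Lemma Leibniz_separation A (F : set A) x y : ~ Leibniz F (x, y) ->
  exists2 t : A -> A, translation t & ~ (F (t x) <-> F (t y)).
Proof.
have [_ _ max] := LeibnizP F.
pose theta : set (A * A) :=
  [set p | forall t : A -> A, translation t -> (F (t p.1) <-> F (t p.2))].
move=> nxy; apply: contrapT => nsep; apply: nxy.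
apply: (max theta).
- apply: congruence_unary => //=.
  + by move=> a b ab t /ab [].
  + by move=> a b c ab bc t tt; rewrite (ab t tt); apply: bc.
  + by move=> f i c a b ab t tt; apply: ab (translation_op i c tt).
- by move=> a b ab; case: (ab id (translation_id A)).
- by move=> t tt /=; apply: contrapT => ntxy; apply: nsep; exists t.
Qed.

(* [p] enumerates the parameters of the unary polynomial [t]; the point [a]
   is used as padding. *)
Lemma translation_parameters A (a : A) (t : A -> A) : translation t ->
  exists p : nat -> A, forall B (h : B -> A), is_hom h ->
    (forall n, exists b, h b = p n) ->
    exists2 t' : B -> B, translation t' & forall b, t (h b) = h (t' b).
Proof.
elim=> [|t' f i c _ [p IH]].
  by exists (fun=> a) => B h _ _; exists id => //; exact: translation_id.
(* The entries of [c] come first; the parameters of [t'] are shifted by [arity f]. *)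
exists (fun n => if insub n is Some j then c j else p (n - arity f)).
move=> B h hom_h ranp.
have [n|u tu tuE] := IH B h hom_h.
  have [b] := ranp (arity f + n).
  by rewrite insubN -?leqNgt ?leq_addr// addKn => <-; exists b.
have /choice[d dE] : forall j, exists b, h b = c j.
  by move=> j; have [b] := ranp j; rewrite valK => <-; exists b.
exists (fun b => u (interp f (fun j => if j == i then b else d j))).
  exact: translation_op.
move=> b; rewrite -tuE hom_h; congr (t' (interp f _)).
by apply/funext => j; case: eqP.
Qed.

(** The pullback of [Leibniz F] along [h] is a congruence compatible with the preimage of [F]. *)
Lemma Leibniz_preimage A B (h : B -> A) (F : set A) x y : is_hom h ->
  Leibniz F (h x, h y) -> Leibniz (h @^-1` F) (x, y).
Proof.
have [[rfl sym trans cong] comp _] := LeibnizP F.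
have [_ _ max] := LeibnizP (h @^-1` F) => hom_h Lxy.
apply: (max [set p : B * B | Leibniz F (h p.1, h p.2)]) => //.
  split=> /=; [by [] | by move=> *; apply: sym | |].
    by move=> a b c; apply: trans.
  by move=> f u v uv; rewrite !hom_h; apply: cong.
by move=> u v /=; apply: comp.
Qed.

End Translations.

Section Terms.
Context {S : algtype} {V : Type}.

Fixpoint eval {A : algebra S} (v : V -> A) (phi : Fm S V) : A :=
  match phi with
  | Var x => v x
  | App f s => interp f (fun i => eval v (s i))
  end.

Lemma eval_hom {A : algebra S} (v : V -> A) : is_hom (eval v).
Proof. by []. Qed.

Lemma Fi_preimage (L : logic S V) (A : algebra S) (h : Fm S V -> A) (F : set A) :
  is_hom h -> Fi L A F -> Th L (h @^-1` F).
Proof.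
move=> hom_h FiF Gamma phi ent sigma hom_s sub.
apply: (FiF _ _ ent (h \o sigma)).
  by move=> f x /=; rewrite hom_s hom_h.
by move=> _ [g Gg <-]; apply: sub; exists g.
Qed.

(** A formula is a finitely branching tree; with its symbols coded by numbers it becomes an element
    of a countable type. *)
Lemma countable_formula : countable [set: op S] -> countable [set: V] ->
  countable [set: Fm S V].
Proof.
move=> /countable_injP[co co_inj] /countable_injP[cv cv_inj].
pose fix code (phi : formula S V) : GenTree.tree nat :=
  match phi with
  | Var x => GenTree.Leaf (cv x)
  | App f s => GenTree.Node (co f) [seq code (s i) | i <- enum 'I_(arity f)]
  end.
apply/countable_injP; exists (pickle \o code).
apply: in2W; apply: inj_comp; first exact: pcan_inj pickleK.
elim=> [x|f s IH] [y|g u] //=.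
  by case=> /cv_inj ->; rewrite ?inE.
case=> /co_inj; rewrite !inE => /(_ I I) fg.
case: _ / fg u => u /eq_in_map E; congr App; apply/funext => i.
by apply: IH; apply: E; rewrite mem_enum.
Qed.

End Terms.

(* The Skolem hull is the set of values of terms over [S] enriched with
   binary operations [n : nat] that name the [n]-th parameter of a unary
   polynomial separating the two arguments. *)
Definition skolem_type (S : algtype) : algtype :=
  {| op := op S + nat;
     arity := fun f => match f with inl g => arity g | inr _ => 2 end |}.

Definition skolem_algebra {S : algtype} {A : algebra S} (p : A -> A -> nat -> A) :
    algebra (skolem_type S) :=
  @Algebra (skolem_type S) A (fun f =>
    match f with
    | inl g => fun x => interp g x
    | inr n => fun x => p (x ord0) (x ord_max) n
    end).

(** Gives the inclusion opposite to [Leibniz_preimage]: the range of [h] is the Skolem hull of [a]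
    and [b], so a translation separating two of its points lifts to formulas. *)
Lemma Leibniz_reflecting_hom (S : algtype) (V : Type) (A : algebra S)
    (F : set A) (a b : A) :
  countable [set: op S] -> infinite_set [set: V] ->
  exists h : Fm S V -> A, [/\ is_hom h, exists x, h x = a, exists y, h y = b &
    forall x y, Leibniz (h @^-1` F) (x, y) -> Leibniz F (h x, h y)].
Proof.
move=> countS infV.
have /choice[p pP] : forall xy : A * A, exists p : nat -> A,
    ~ Leibniz F xy -> exists2 t : A -> A, ~ (F (t xy.1) <-> F (t xy.2)) &
      forall (B : algebra S) (h : B -> A), is_hom h ->
        (forall n, exists b, h b = p n) ->
        exists2 t' : B -> B, translation t' & forall b, t (h b) = h (t' b).
  move=> [x y].
  have [Lxy|/Leibniz_separation[t tt sep]] := pselect (Leibniz F (x, y)).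
    (* Congruent pairs need no parameters and get a dummy sequence. *)
    by exists (fun=> a).
  by have [p pP] := translation_parameters a tt; exists p => _; exists t.
pose T := Fm (skolem_type S) bool.
pose ev : T -> A :=
  @eval (skolem_type S) bool (skolem_algebra (fun x y => p (x, y)))
    (fun c => if c then a else b).
have countT : countable [set: T].
  apply: countable_formula => //; have /countable_injP[co co_inj] := countS.
  apply/countable_injP.
  exists (fun f : op S + nat => match f with
    inl g => pickle (inl (co g) : nat + nat) | inr n => pickle (inr n : nat + nat) end).
  move=> [f|m] [g|n] _ _ /(pcan_inj pickleK)// [].
    by move=> /co_inj ->; rewrite ?inE.
  by move=> ->.
(* An infinite [V] maps onto the naturals, and a left inverse [d] of the coding maps these onto the
   countable type [T]. *)
have [s sP] : exists s : V -> T, forall u, exists x, s x = u.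
  have /infiniteP/pcard_surjP[g g_surj] := infV.
  have /countable_injP[code code_inj] := countT.
  have /choice[d dP] : forall n, exists u : T, forall w, code w = n -> w = u.
    move=> n; have [[u <-]|nu] := pselect (exists u, code u = n).
      by exists u => w /code_inj; apply; rewrite inE.
    by exists (Var _ true) => w wn; case: nu; exists w.
  exists (d \o g) => u; have [x _ gx] := g_surj (code u) I.
  by exists x; rewrite /= (dP (g x) u).
pose h := eval (ev \o s).
have ran_ev u : exists x, h x = ev u by have [x <-] := sP u; exists (Var S x).
(* The hull is closed under the operations of [S], so [h] does not leave it. *)
have ran_h phi : exists u, ev u = h phi.
  elim: phi => [x|f x /choice[u uP]]; first by exists (s x).
  exists (@App (skolem_type S) bool (inl f) u) => /=; congr interp.
  by apply/funext => i; exact: uP.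
exists h; split=> //.
- exact: (ran_ev (Var _ true)).
- exact: (ran_ev (Var _ false)).
move=> x y Lxy; apply: contrapT => /pP[t /= sep].
have [u uE] := ran_h x; have [w wE] := ran_h y.
move=> /(_ (Fm S V) h (eval_hom _))[n|t' tt' tE].
  (* The [n]-th parameter for [(h x, h y)] is the value of the Skolem operation [inr n] at terms
     naming [h x] and [h y]. *)
  have := ran_ev (@App (skolem_type S) bool (inr n)
                  (fun i => if i == ord0 then u else w)).
  by rewrite /ev /= -/ev uE wE.
apply: sep; rewrite !tE.
have [cong comp _] := LeibnizP (h @^-1` F).
have [_ sym _ _] := cong.
have Lt := congruence_translation cong tt' Lxy.
by split; apply: comp => //; apply: sym.
Qed.

Theorem theorem7p4 (S : algtype) (countable_language : countable [set: op S])
    (V : Type) (countable_V : countable [set: V])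
    (infinite_V : infinite_set [set: V]) (L : logic S V) :
  (order_reflecting (Th L) ->
     forall A : algebra S, order_reflecting (Fi L A)) /\
  (almost_order_reflecting (Th L) ->
     forall A : algebra S, almost_order_reflecting (Fi L A)).
Proof.
split=> refl A F G FiF FiG => [FG a Fa|_ [b Gb] FG a Fa].
  (* Only [a] has to be in the range here, so it serves as both generators. *)
  have [h [hom_h [x xE] _ hL]] :=
    @Leibniz_reflecting_hom S V A F a a countable_language infinite_V.
  rewrite -xE; apply: (refl (h @^-1` F) (h @^-1` G)); rewrite /= ?xE //.
  - exact: Fi_preimage.
  - exact: Fi_preimage.
  - by move=> [u w] /hL/FG; apply: Leibniz_preimage.
(* The generators [a] and [b] make the preimages of [F] and of [G] non-empty. *)
have [h [hom_h [x xE] [y yE] hL]] :=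
  @Leibniz_reflecting_hom S V A F a b countable_language infinite_V.
rewrite -xE; apply: (refl (h @^-1` F) (h @^-1` G)); rewrite /= ?xE //.
- exact: Fi_preimage.
- exact: Fi_preimage.
- by exists x; rewrite /= xE.
- by exists y; rewrite /= yE.
- by move=> [u w] /hL/FG; apply: Leibniz_preimage.
Qed.
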